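(* Let $A$ be a finite alphabet and let $f\colon A^*\to A^*$ be a Parikh-collinear morphism prolongable on the letter $a\in A$. Let $\mathbf{x}:=f^{\omega}(a)$ and let $k=\sum_{b\in A}|f(b)|_b$ be the eigenvalue of $f$. Then the abelian complexity function $\rho^{\mathrm{ab}}_{\mathbf{x}}\colon\mathbb{N}\to\mathbb{N}$ of $\mathbf{x}$ is $k$-automatic. Moreover, a deterministic finite automaton with output generating $\rho^{\mathrm{ab}}_{\mathbf{x}}$ can be effectively computed from $f$ and $a$.
   Context: The alphabet is ordered, $A=\{a_1<\cdots<a_m\}$, and for $w\in A^*$ the Parikh vector is $\Psi(w)=(|w|_{a_1},\ldots,|w|_{a_m})$, where $|w|_b$ is the number of occurrences of $b$ in $w$. A morphism $f\colon A^*\to A^*$ is Parikh-collinear if the vectors $\Psi(f(b))$, $b\in A$, are pairwise collinear (any two are $\mathbb{Z}$-linearly dependent); $f$ may be erasing (some $f(b)$ may be empty). $f$ is prolongable on $a$ if $f(a)=au$ for some word $u$ and $|f^n(a)|\to\infty$; then $f^{\omega}(a)=\lim_n f^n(a)$ is the infinite fixed point of $f$ starting with $a$. The number $k=\sum_{b\in A}|f(b)|_b$ is called the eigenvalue of $f$. The abelian complexity of an infinite word $\mathbf{x}$ is $\rho^{\mathrm{ab}}_{\mathbf{x}}(n)=\#\{\Psi(w)\colon w \text{ a factor of } \mathbf{x},\ |w|=n\}$. A sequence $(s(n))_{n\ge0}$ is $k$-automatic if there is a deterministic finite automaton with output which, reading the base-$k$ representation of $n$, outputs $s(n)$. *)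

(* Defs.v *)
From HB Require Import structures.
From mathcomp Require Import all_boot all_order all_algebra finmap.
From mathcomp Require Import boolp classical_sets cardinality.

Set Implicit Arguments.
Unset Strict Implicit.
Unset Printing Implicit Defensive.

Import GRing.Theory Num.Theory.

Section Words.
Variable A : finType.
Implicit Types (f : seq A -> seq A) (a b c : A) (u v w : seq A) (x : nat -> A).

(* The order on the alphabet is that of [enum A]; a Parikh vector is indexed
   directly by the letters. *)
Definition parikh w : {ffun A -> nat} := [ffun b => count_mem b w].

(* [f [::] = [::]] follows. *)
Definition word_morphism f : Prop := {morph f : u v / u ++ v}.

Definition collinear (X Y : {ffun A -> nat}) : Prop :=
  exists p q : int, (p, q) <> (0, 0)%R /\
    forall c, (p * (X c)%:Z + q * (Y c)%:Z = 0)%R.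

Definition parikh_collinear f : Prop :=
  forall b c, collinear (parikh (f [:: b])) (parikh (f [:: c])).

Definition prolongable f a : Prop :=
  (exists u, f [:: a] = a :: u) /\
  (forall N, exists n0, forall n, n0 <= n -> N <= size (iter n f [:: a])).

(* Limit of a sequence of finite words: each position is eventually defined
   and constant. *)
Definition word_lim (u : nat -> seq A) x : Prop :=
  forall i, exists n0, forall n, n0 <= n -> onth (u n) i = Some (x i).

(* [x] is the infinite word f^omega(a). *)
Definition fixed_point f a x : Prop := word_lim (fun n => iter n f [:: a]) x.

Definition eigenvalue f : nat := \sum_(b : A) count_mem b (f [:: b]).

Definition factor x w : Prop :=
  exists i, w = mkseq (fun j => x (i + j)) (size w).

(* The set is finite since A is, so [fset_set] does not take its default
   value here. *)
Definition abelian_complexity x (n : nat) : nat :=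
  #|` fset_set [set parikh w | w in [set w | factor x w /\ size w = n]]%classic |%fset.

End Words.

(* Deterministic finite automata with output over the digits 0, ..., k-1. *)
Record dfao (k : nat) (T : Type) := Dfao {
  dfao_state : finType;
  dfao_init : dfao_state;
  dfao_trans : dfao_state -> 'I_k -> dfao_state;
  dfao_out : dfao_state -> T }.

Definition dfao_run k T (D : dfao k T) (w : seq 'I_k) : T :=
  dfao_out (foldl (@dfao_trans k T D) (dfao_init D) w).

(* Most significant digit first, no leading zero; 0 is represented by the
   empty word. *)
Definition base_repr (k n : nat) (w : seq 'I_k) : Prop :=
  foldl (fun m (d : 'I_k) => m * k + d) 0 w = n /\
  (forall d w', w = d :: w' -> d != 0 :> nat).

Definition generates k T (D : dfao k T) (s : nat -> T) : Prop :=
  forall n w, base_repr n w -> dfao_run D w = s n.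

(* For k <= 1 almost no integer has a representation in the above sense. *)
Definition automatic k T (s : nat -> T) : Prop :=
  1 < k /\ exists D : dfao k T, generates D s.

(* Programs for the partial recursive functions on tuples of naturals. Arities
   are not enforced: RSucc and RProj read a missing argument as 0. *)
Inductive recprog : Type :=
| RZero
| RSucc
| RProj of nat
| RComp of recprog & seq recprog
| RPrec of recprog & recprog
| RMin of recprog.

(* [rec_eval p xs y]: program [p] halts on input [xs] with value [y]. *)
Inductive rec_eval : recprog -> seq nat -> nat -> Prop :=
| EvZero xs : rec_eval RZero xs 0
| EvSucc xs : rec_eval RSucc xs (nth 0 xs 0).+1
| EvProj i xs : rec_eval (RProj i) xs (nth 0 xs i)
| EvComp g hs xs ys z :
    size ys = size hs ->
    (forall i, i < size hs -> rec_eval (nth RZero hs i) xs (nth 0 ys i)) ->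
    rec_eval g ys z ->
    rec_eval (RComp g hs) xs z
| EvPrec0 g h xs z :
    rec_eval g xs z -> rec_eval (RPrec g h) (0 :: xs) z
| EvPrecS g h n xs r z :
    rec_eval (RPrec g h) (n :: xs) r ->
    rec_eval h (n :: r :: xs) z ->
    rec_eval (RPrec g h) (n.+1 :: xs) z
| EvMin g xs y (v : nat -> nat) :
    (forall z, z < y -> rec_eval g (z :: xs) (v z).+1) ->
    rec_eval g (y :: xs) 0 ->
    rec_eval (RMin g) xs y.

(* [CodeSeq.code] is the bijection from [seq nat] to [nat] given by
   code [::] = 0 and code (n :: s) = 2 ^ n * (2 * code s + 1). *)
Definition code_table (t : seq (seq nat)) : nat :=
  CodeSeq.code [seq CodeSeq.code r | r <- t].

Definition code_word (A : finType) (w : seq A) : seq nat :=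
  [seq nat_of_ord (enum_rank c) | c <- w].

(* The finite data (f, a): the index of [a] and the list of the images of the
   letters, in order. *)
Definition code_instance (A : finType) (f : seq A -> seq A) (a : A) : nat :=
  CodeSeq.code [:: nat_of_ord (enum_rank a);
                   code_table [seq code_word (f [:: b]) | b <- enum A]].

(* The initial state, the transition table (one row per state, one column per
   digit) and the list of outputs. *)
Definition code_dfao k (D : dfao k nat) : nat :=
  CodeSeq.code
    [:: nat_of_ord (enum_rank (dfao_init D));
        code_table [seq code_word [seq dfao_trans q d | d <- enum 'I_k]
                   | q <- enum (dfao_state D)];
        CodeSeq.code [seq dfao_out q | q <- enum (dfao_state D)]].

(* Main.v *)
Require Import Defs.
From mathcomp Require Import all_boot.
From mathcomp Require Import ssralg ssrnum ssrint finmap.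
From mathcomp Require Import boolp classical_sets cardinality zify.

(* Each position p of x = f(x_0) f(x_1) ... lies in a block f(x_j), at some offset
   o; let y_p = (x_j, o). Collinearity gives |f(f(w))| = k |f(w)|, so cutting
   the word f(f(b)) into |f(b)| pieces of length k turns y into a fixed point of
   a k-uniform substitution: y_(kp+d) is a function of y_p and d. Moreover the
   Parikh vector of the prefix of length p is (p - o) / |f(a)| times Psi(f(a)) plus
   Psi(f(x_j)[0..o)), so the Parikh vectors of the factors of length n are determined
   by n and the pairs (y_i, y_(i+n)), and whether two of them coincide depends
   on the pairs only. The set of triples (y_i, y_(i+n), y_(i+n+1)) for n = km+d
   is a function of d and of the same set for m; these sets, as bitmasks, are the
   states of the automaton. The automaton is primitive recursive in the table of the
   images of the letters. *)

Set Implicit Arguments.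
Unset Strict Implicit.
Unset Printing Implicit Defensive.

Import GRing.Theory Num.Theory.

(** * Closure properties of computable functions *)

(** Tuples are nested pairs, so that a function of the inputs is a term in projections such as
    [u.2.1], on which [computability_step] can match. *)
Fixpoint env (n : nat) : Type := if n is n'.+1 then (nat * env n')%type else unit.

Fixpoint env_seq n : env n -> seq nat :=
  if n is n'.+1 then fun u => u.1 :: env_seq u.2 else fun=> [::].

Definition computable n (F : env n -> nat) : Prop :=
  exists p, forall u, rec_eval p (env_seq u) (F u).

Definition computable1 (h : nat -> nat) := computable (fun u : env 1 => h u.1).
Definition computable2 (h : nat -> nat -> nat) :=
  computable (fun u : env 2 => h u.1 u.2.1).
Definition computable3 (h : nat -> nat -> nat -> nat) :=
  computable (fun u : env 3 => h u.1 u.2.1 u.2.2.1).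
Definition computable4 (h : nat -> nat -> nat -> nat -> nat) :=
  computable (fun u : env 4 => h u.1 u.2.1 u.2.2.1 u.2.2.2.1).

Lemma size_env_seq n (u : env n) : size (env_seq u) = n.
Proof. by elim: n u => [|n IH] u //=; rewrite IH. Qed.

Lemma computable_eq n (F G : env n -> nat) : F =1 G -> computable F -> computable G.
Proof. by move=> FG [p Hp]; exists p => u; rewrite -FG. Qed.

Lemma computable_nth n i : computable (fun u : env n => nth 0 (env_seq u) i).
Proof. by exists (RProj i) => u; apply: EvProj. Qed.

Lemma computable_const n c : computable (fun _ : env n => c).
Proof.
elim: c => [|c [p Hp]]; first by exists RZero => u; apply: EvZero.
exists (RComp RSucc [:: p]) => u; apply: (@EvComp _ _ _ [:: c]) => //.
  by case.
exact: EvSucc [:: c].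
Qed.

(** Programs for the components of [h] are chained by [RComp]. Components of index at least l are
    the default 0, so all i can be allowed and [choice] picks one program per index. *)
Lemma computable_comp n l (G : env l -> nat) (h : env n -> env l) :
    computable G ->
    (forall i, computable (fun u => nth 0 (env_seq (h u)) i)) ->
  computable (fun u => G (h u)).
Proof.
move=> [p Hp] /choice[hs Hhs]; exists (RComp p (mkseq hs l)) => u.
apply: (@EvComp _ _ _ (env_seq (h u))) => //.
  by rewrite size_env_seq size_mkseq.
by move=> i; rewrite size_mkseq => lt_il; rewrite nth_mkseq.
Qed.

Lemma computable_fst n : computable (fun u : env n.+1 => u.1).
Proof. exact: (computable_nth n.+1 0). Qed.

Lemma computable_weaken n (F : env n -> nat) :
  computable F -> computable (fun u : env n.+1 => F u.2).
Proof.
by move=> cF; apply: (computable_comp cF) => i; apply: (computable_nth n.+1 i.+1).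
Qed.

Lemma computable_let n (N : env n -> nat) (F : env n.+1 -> nat) :
  computable N -> computable F -> computable (fun u => F (N u, u)).
Proof.
move=> cN cF.
apply: (computable_comp (l := n.+1) (h := fun u => (N u, u)) cF) => -[|i] //.
exact: (computable_nth n i).
Qed.

Lemma computable_app1 n h (F : env n -> nat) :
  computable1 h -> computable F -> computable (fun u => h (F u)).
Proof.
move=> ch cF; apply: (computable_comp (h := fun u => (F u, tt) : env 1) ch).
by move=> [|[|i]] //; apply: computable_const.
Qed.

Lemma computable_app2 n h (F G : env n -> nat) :
  computable2 h -> computable F -> computable G ->
  computable (fun u => h (F u) (G u)).
Proof.
move=> ch cF cG.
apply: (computable_comp (h := fun u => (F u, (G u, tt)) : env 2) ch).
by move=> [|[|[|i]]] //; apply: computable_const.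
Qed.

Lemma computable_app3 n h (F G H : env n -> nat) :
  computable3 h -> computable F -> computable G -> computable H ->
  computable (fun u => h (F u) (G u) (H u)).
Proof.
move=> ch cF cG cH.
apply: (computable_comp (h := fun u => (F u, (G u, (H u, tt))) : env 3) ch).
by move=> [|[|[|[|i]]]] //; apply: computable_const.
Qed.

Lemma computable_app4 n h (F G H K : env n -> nat) :
  computable4 h -> computable F -> computable G -> computable H ->
  computable K -> computable (fun u => h (F u) (G u) (H u) (K u)).
Proof.
move=> ch cF cG cH cK.
apply: (computable_comp (h := fun u => (F u, (G u, (H u, (K u, tt)))) : env 4) ch).
by move=> [|[|[|[|[|i]]]]] //; apply: computable_const.
Qed.

Lemma computable_S n (F : env n -> nat) :
  computable F -> computable (fun u => (F u).+1).
Proof.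
by apply: computable_app1; exists RSucc => u; apply: (EvSucc (env_seq u)).
Qed.

Lemma computable_rec n (N G : env n -> nat) (H : nat -> nat -> env n -> nat) :
    computable N -> computable G ->
    computable (fun u : env n.+2 => H u.1 u.2.1 u.2.2) ->
  computable (fun u => nat_rec (fun=> nat) (G u) (fun i r => H i r u) (N u)).
Proof.
move=> cN [pG HG] [pH HH].
(* The bound becomes the first input, the one on which [RPrec] recurses. *)
apply: (computable_let (F := fun u => nat_rec (fun=> nat) (G u.2)
  (fun i r => H i r u.2) u.1)) => //.
exists (RPrec pG pH) => -[i u] /=; elim: i => [|i IH] /=.
  exact: EvPrec0.
by apply: (EvPrecS IH); apply: (HH (i, (_, u))).
Qed.

Lemma computable_iter n (N G : env n -> nat) (H : nat -> env n -> nat) :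
    computable N -> computable G ->
    computable (fun u : env n.+1 => H u.1 u.2) ->
  computable (fun u => iter (N u) (H^~ u) (G u)).
Proof.
move=> cN cG cH.
apply: (computable_eq (F := fun u => nat_rec _ (G u) (fun i r => H r u) (N u))).
  by move=> u; elim: (N u) => //= i ->.
apply: (computable_rec (H := fun i r u => H r u)) => //.
exact: (computable_weaken (F := fun u : env n.+1 => H u.1 u.2)).
Qed.

(** * Arithmetic, boolean tests and bounded operators *)

Lemma computable_add2 : computable2 addn.
Proof.
apply: (computable_eq (F := fun u : env 2 => iter u.1 (fun r => r.+1) u.2.1)).
  by move=> u /=; elim: u.1 => //= i ->.
apply: (computable_iter (H := fun r u => r.+1)).
- exact: computable_fst.
- exact: computable_weaken (computable_fst _).
- exact: computable_S (computable_fst _).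
Qed.

Lemma computable_pred1 : computable1 predn.
Proof.
apply: (computable_eq (F := fun u : env 1 =>
   nat_rec (fun=> nat) 0 (fun i r => i) u.1)); first by move=> [[]].
apply: (computable_rec (G := fun=> 0) (H := fun i r u => i));
  by [exact: computable_fst | exact: computable_const].
Qed.

Lemma computable_sub2 : computable2 subn.
Proof.
apply: (computable_eq (F := fun u : env 2 => iter u.2.1 predn u.1)).
  move=> u /=; elim: u.2.1 => [|i IH] /=; first by rewrite subn0.
  by rewrite IH subnS.
apply: (computable_iter (H := fun r u => r.-1)).
- exact: computable_weaken (computable_fst _).
- exact: computable_fst.
- exact: computable_app1 computable_pred1 (computable_fst _).
Qed.

Lemma computable_mul2 : computable2 muln.
Proof.
apply: (computable_eq (F := fun u : env 2 => iter u.1 (addn u.2.1) 0)).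
  by move=> u /=; rewrite iter_addn_0 mulnC.
apply: (computable_iter (G := fun=> 0) (H := fun r (u : env 2) => u.2.1 + r)).
- exact: computable_fst.
- exact: computable_const.
- apply: (computable_app2 computable_add2) (computable_fst _).
  exact: computable_weaken (computable_weaken (computable_fst _)).
Qed.

Lemma computable_exp2 : computable2 expn.
Proof.
apply: (computable_eq (F := fun u : env 2 => iter u.2.1 (muln u.1) 1)).
  by move=> u /=; rewrite iter_muln_1.
apply: (computable_iter (G := fun=> 1) (H := fun r (u : env 2) => u.1 * r)).
- exact: computable_weaken (computable_fst _).
- exact: computable_const.
- apply: (computable_app2 computable_mul2) (computable_fst _).
  exact: computable_weaken (computable_fst _).
Qed.

Lemma computable_add n (F G : env n -> nat) :
  computable F -> computable G -> computable (fun u => F u + G u).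
Proof. exact: computable_app2 computable_add2. Qed.

Lemma computable_sub n (F G : env n -> nat) :
  computable F -> computable G -> computable (fun u => F u - G u).
Proof. exact: computable_app2 computable_sub2. Qed.

Lemma computable_mul n (F G : env n -> nat) :
  computable F -> computable G -> computable (fun u => F u * G u).
Proof. exact: computable_app2 computable_mul2. Qed.

Lemma computable_exp n (F G : env n -> nat) :
  computable F -> computable G -> computable (fun u => F u ^ G u).
Proof. exact: computable_app2 computable_exp2. Qed.

Lemma computable_eq0 n (F : env n -> nat) :
  computable F -> computable (fun u => F u == 0 : nat).
Proof.
move=> cF; apply: (computable_eq (F := fun u => 1 - F u)).
  by move=> u; case: (F u).
by apply: computable_sub cF; apply: computable_const.
Qed.

Lemma computable_leq n (F G : env n -> nat) :
  computable F -> computable G -> computable (fun u => F u <= G u : nat).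
Proof. by move=> cF cG; apply: computable_eq0; apply: computable_sub. Qed.

Lemma computable_and n (b c : env n -> bool) :
    computable (fun u => b u : nat) -> computable (fun u => c u : nat) ->
  computable (fun u => b u && c u : nat).
Proof.
move=> cb cc; apply: (computable_eq (F := fun u => b u * c u)).
  by move=> u; rewrite mulnb.
exact: computable_mul.
Qed.

Lemma computable_not n (b : env n -> bool) :
  computable (fun u => b u : nat) -> computable (fun u => ~~ b u : nat).
Proof.
move=> cb; apply: (computable_eq (F := fun u => b u == 0 :> nat)).
  by move=> u; case: (b u).
exact: computable_eq0.
Qed.

Lemma computable_or n (b c : env n -> bool) :
    computable (fun u => b u : nat) -> computable (fun u => c u : nat) ->
  computable (fun u => b u || c u : nat).
Proof.
move=> cb cc; apply: (computable_eq (F := fun u => ~~ (~~ b u && ~~ c u) : nat)).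
  by move=> u; rewrite negb_and !negbK.
by apply: computable_not; apply: computable_and; apply: computable_not.
Qed.

Lemma computable_eqn n (F G : env n -> nat) :
  computable F -> computable G -> computable (fun u => F u == G u : nat).
Proof.
move=> cF cG; apply: (computable_eq (F := fun u => (F u <= G u) && (G u <= F u) : nat)).
  by move=> u; rewrite -eqn_leq.
by apply: computable_and; apply: computable_leq.
Qed.

Lemma computable_if n (b : env n -> bool) (F G : env n -> nat) :
    computable (fun u => b u : nat) -> computable F -> computable G ->
  computable (fun u => if b u then F u else G u).
Proof.
move=> cb cF cG.
apply: (computable_eq (F := fun u => b u * F u + ~~ b u * G u)).
  by move=> u; case: (b u); rewrite ?mul1n ?mul0n ?addn0.
by apply: computable_add; apply: computable_mul => //; apply: computable_not.
Qed.

Lemma computable_sum n (N : env n -> nat) (F : nat -> env n -> nat) :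
    computable N -> computable (fun u : env n.+1 => F u.1 u.2) ->
  computable (fun u => \sum_(0 <= i < N u) F i u).
Proof.
move=> cN cF; apply: (computable_eq (F := fun u =>
    nat_rec (fun=> nat) 0 (fun i r => r + F i u) (N u))).
  move=> u; elim: (N u) => [|i IH] /=; first by rewrite big_geq.
  by rewrite big_nat_recr //= IH.
apply: (computable_rec (G := fun=> 0) (H := fun i r u => r + F i u)) => //.
  exact: computable_const.
apply: computable_add; first exact: computable_weaken (computable_fst _).
apply: (computable_comp (l := n.+1) (h := fun u : env n.+2 => (u.1, u.2.2)) cF).
move=> [|i]; first exact: computable_fst.
exact: (computable_nth n.+2 i.+2).
Qed.

Lemma computable_has n (N : env n -> nat) (b : nat -> env n -> bool) :
    computable N -> computable (fun u : env n.+1 => b u.1 u.2 : nat) ->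
  computable (fun u => has (b^~ u) (iota 0 (N u)) : nat).
Proof.
move=> cN cb.
apply: (computable_eq (F := fun u => 0 < \sum_(0 <= i < N u) b i u : nat)).
  move=> u; rewrite /index_iota subn0 has_count -sum1_count.
  by rewrite [in RHS]big_mkcond.
apply: computable_leq; first exact: computable_const.
exact: (computable_sum (F := fun i u => b i u : nat)).
Qed.

(** A code is built from the tail of the list, so the recursion takes the entries from the last to
    the first: after i steps it holds the code of the last i entries. *)
Lemma computable_code_mkseq n (N : env n -> nat) (F : nat -> env n -> nat) :
    computable N -> computable (fun u : env n.+1 => F u.1 u.2) ->
  computable (fun u => CodeSeq.code (mkseq (F^~ u) (N u))).
Proof.
move=> cN cF; apply: (computable_eq (F := fun u => nat_rec (fun=> nat) 0
    (fun i r => 2 ^ F (N u - i.+1) u * (2 * r).+1) (N u))).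
  move=> u; suff code_iota i : i <= N u -> nat_rec (fun=> nat) 0
      (fun j r => 2 ^ F (N u - j.+1) u * (2 * r).+1) i =
      CodeSeq.code [seq F j u | j <- iota (N u - i) i].
    by rewrite code_iota // subnn.
  elim: i => [|i IH] //= lt_i.
  by rewrite IH 1?ltnW // mul2n -subSn // subSS.
apply: (computable_rec (G := fun=> 0)
  (H := fun i r u => 2 ^ F (N u - i.+1) u * (2 * r).+1)) => //.
  exact: computable_const.
apply: computable_mul; first (apply: computable_exp; first exact: computable_const).
  apply: (computable_comp (l := n.+1)
    (h := fun u : env n.+2 => (N u.2.2 - u.1.+1, u.2.2)) cF).
  move=> [|i]; last exact: (computable_nth n.+2 i.+2).
  apply: computable_sub; last exact: computable_S (computable_fst _).
  exact: (computable_weaken (computable_weaken cN)).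
apply: computable_S; apply: computable_mul; first exact: computable_const.
exact: computable_weaken (computable_fst _).
Qed.

(** * Codes of lists *)

Lemma computable_divn : computable2 divn.
Proof.
(* The quotient m / d is the number of i < m with (i + 1) d <= m. For d = 0 every i would count,
   whereas [m %/ 0] is 0. *)
apply: (computable_eq (F := fun u : env 2 =>
   if u.2.1 == 0 then 0 else \sum_(0 <= i < u.1) (i.+1 * u.2.1 <= u.1 : nat))).
  move=> [m [[|d] /= _]]; first by rewrite divn0.
  rewrite -(big_mkcond (fun i => i.+1 * d.+1 <= m) (fun=> 1)) sum1_count.
  rewrite (eq_count (a2 := fun i => i < m %/ d.+1)); last first.
    by move=> i; rewrite leq_divRL.
  rewrite -size_filter /index_iota subn0 (@filter_iota_ltn 0) ?size_iota //.
  exact: leq_div.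
apply: (computable_if (b := fun u : env 2 => u.2.1 == 0)).
- exact: computable_eq0 (computable_weaken (computable_fst _)).
- exact: computable_const.
apply: (computable_sum (F := fun i (u : env 2) => i.+1 * u.2.1 <= u.1 : nat)).
  exact: computable_fst.
apply: computable_leq; last exact: (computable_nth 3 1).
apply: computable_mul; last exact: (computable_nth 3 2).
exact: computable_S (computable_fst _).
Qed.

Create HintDb computable.
#[local] Hint Resolve computable_divn : computable.

(** Second-order patterns split the body along its outermost operator. Named functions are resolved
    by the hint database; their patterns come last because they also match the arithmetic
    operators. *)
Ltac computability_step :=
  match goal with
  | |- computable (fun _ => ?c) => exact (computable_const _ c)
  | |- computable (fun u => u.1) => exact (computable_fst _)
  | |- computable (fun u => u.2.1) => exact (computable_weaken (computable_fst _))
  | |- computable (fun u => fst _) => first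
      [ exact (computable_weaken (computable_weaken (computable_fst _)))
      | exact (computable_weaken (computable_weaken (computable_weaken
          (computable_fst _))))
      | exact (computable_weaken (computable_weaken (computable_weaken
          (computable_weaken (computable_fst _)))))
      | exact (computable_weaken (computable_weaken (computable_weaken
          (computable_weaken (computable_weaken (computable_fst _))))))
      | exact (computable_weaken (computable_weaken (computable_weaken
          (computable_weaken (computable_weaken (computable_weaken
          (computable_fst _))))))) ]
  | |- computable (fun u => (@?F u).+1) => apply (computable_S (F := F))
  | |- computable (fun u => @?F u + @?G u) => apply (computable_add (F := F) (G := G))
  | |- computable (fun u => @?F u - @?G u) => apply (computable_sub (F := F) (G := G))
  | |- computable (fun u => @?F u * @?G u) => apply (computable_mul (F := F) (G := G))
  | |- computable (fun u => @?F u ^ @?G u) => apply (computable_exp (F := F) (G := G))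
  | |- computable (fun u => nat_of_bool (@?F u == 0)) =>
      apply (computable_eq0 (F := F))
  | |- computable (fun u => nat_of_bool (@?F u == @?G u)) =>
      apply (computable_eqn (F := F) (G := G))
  | |- computable (fun u => nat_of_bool (@?F u <= @?G u)) =>
      apply (computable_leq (F := F) (G := G))
  | |- computable (fun u => nat_of_bool (@?F u && @?G u)) =>
      apply (computable_and (b := F) (c := G))
  | |- computable (fun u => nat_of_bool (@?F u || @?G u)) =>
      apply (computable_or (b := F) (c := G))
  | |- computable (fun u => nat_of_bool (~~ @?F u)) =>
      apply (computable_not (b := F))
  | |- computable (fun u => if _ then _ else _) => apply computable_if
  | |- computable (fun u => \sum_(0 <= i < @?N u) @?F u i) =>
      apply (computable_sum (N := N) (F := fun i u => F u i))
  | |- computable (fun u => nat_of_bool (has (@?b u) (iota 0 (@?N u)))) =>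
      apply (computable_has (N := N) (b := fun i u => b u i))
  | |- computable (fun u => iter (@?N u) (@?H u) (@?G u)) =>
      apply (computable_iter (N := N) (G := G) (H := fun i u => H u i))
  | |- computable (fun u => CodeSeq.code (mkseq (@?F u) (@?N u))) =>
      apply (computable_code_mkseq (N := N) (F := fun i u => F u i))
  | |- computable (fun u => ?h (@?F u) (@?G u) (@?H u) (@?K u)) =>
      apply (computable_app4 (h := h) (F := F) (G := G) (H := H) (K := K));
      [solve [auto with computable nocore] | | | | ]
  | |- computable (fun u => ?h (@?F u) (@?G u) (@?H u)) =>
      apply (computable_app3 (h := h) (F := F) (G := G) (H := H));
      [solve [auto with computable nocore] | | | ]
  | |- computable (fun u => ?h (@?F u) (@?G u)) =>
      apply (computable_app2 (h := h) (F := F) (G := G));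
      [solve [auto with computable nocore] | | ]
  | |- computable (fun u => ?h (@?F u)) =>
      apply (computable_app1 (h := h) (F := F));
      [solve [auto with computable nocore] | ]
  end; cbv beta.

Ltac computability := repeat computability_step.

Lemma computable_modn : computable2 modn.
Proof.
apply: (computable_eq (F := fun u : env 2 => u.1 - u.1 %/ u.2.1 * u.2.1)).
  by move=> u; rewrite {1}(divn_eq u.1 u.2.1) addKn.
by computability.
Qed.
#[local] Hint Resolve computable_modn : computable.

Lemma computable_logn2 : computable1 (logn 2).
Proof.
apply: (computable_eq (F := fun u : env 1 => \sum_(0 <= i < u.1)
   ((i != 0) && (u.1 %% 2 ^ i == 0) : nat))).
  move=> [[|n] _] /=; first by rewrite big_geq.
  rewrite logn_count_dvd // big_ltn // add0n.
  by apply: eq_big_nat => -[|i].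
by computability.
Qed.
#[local] Hint Resolve computable_logn2 : computable.

(** In 2^n (2c + 1) the head n is the 2-adic valuation, and the code c of the tail is the odd part
    halved and rounded down. The value at 0, the code of the empty list, is 0. *)
Definition code_behead c := (c %/ 2 ^ logn 2 c) %/ 2.
Definition code_nth c i := logn 2 (iter i code_behead c).
(** A list is at most as long as its code, so c bounds the number of nonempty suffixes. *)
Definition code_size c := \sum_(0 <= i < c) (iter i code_behead c != 0 : nat).

Lemma code_consE n s :
  CodeSeq.code (n :: s) = 2 ^ n * (CodeSeq.code s).*2.+1.
Proof. by []. Qed.

Lemma logn_code_cons n s : logn 2 (CodeSeq.code (n :: s)) = n.
Proof.
rewrite code_consE lognM ?expn_gt0 // pfactorK // (_ : logn 2 _.+1 = 0) ?addn0 //.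
by rewrite lognE /= dvdn2 /= odd_double.
Qed.

Lemma code_behead_cons n s : code_behead (CodeSeq.code (n :: s)) = CodeSeq.code s.
Proof.
by rewrite /code_behead logn_code_cons mulKn ?expn_gt0 // divn2 /= uphalf_double.
Qed.

Lemma iter_code_behead s i :
  iter i code_behead (CodeSeq.code s) = CodeSeq.code (drop i s).
Proof.
elim: i s => [|i IH] [|n s] //; first by rewrite iterS IH.
by rewrite iterSr code_behead_cons IH.
Qed.

Lemma code_nthE s i : code_nth (CodeSeq.code s) i = nth 0 s i.
Proof.
rewrite /code_nth iter_code_behead -[i in RHS]addn0 -nth_drop.
by case: (drop i s) => [|n t] //; rewrite logn_code_cons.
Qed.

Lemma size_le_code s : size s <= CodeSeq.code s.
Proof.
elim: s => //= n s IH; apply: leq_trans (leq_pmull _ (expn_gt0 2 n)) .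
by rewrite ltnS -addnn (leq_trans IH) ?leq_addr.
Qed.

Lemma code_sizeE s : code_size (CodeSeq.code s) = size s.
Proof.
rewrite /code_size.
rewrite (eq_bigr (fun i => i < size s : nat)) => [|i _]; last first.
  rewrite iter_code_behead ltnNge -subn_eq0 -size_drop.
  by case: (drop i s) => //= n t; rewrite muln_eq0 expn_eq0.
rewrite -(big_mkcond (fun i => i < size s) (fun=> 1)) sum1_count -size_filter.
by rewrite /index_iota subn0 (@filter_iota_ltn 0) ?size_iota ?size_le_code.
Qed.

Lemma computable_code_behead : computable1 code_behead.
Proof. by rewrite /computable1 /code_behead; computability. Qed.
#[local] Hint Resolve computable_code_behead : computable.

Lemma computable_code_nth : computable2 code_nth.
Proof. by rewrite /computable2 /code_nth; computability. Qed.
#[local] Hint Resolve computable_code_nth : computable.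

Lemma computable_code_size : computable1 code_size.
Proof. by rewrite /computable1 /code_size; computability. Qed.
#[local] Hint Resolve computable_code_size : computable.

(** * The automaton of windows *)

Definition bit q t := (q %/ 2 ^ t) %% 2 != 0.

Definition bitmask M (P : nat -> bool) := \sum_(0 <= t < M) P t * 2 ^ t.

Lemma bitmask_recr M P : bitmask M.+1 P = bitmask M P + P M * 2 ^ M.
Proof. by rewrite /bitmask big_nat_recr. Qed.

Lemma bitmask_lt M P : bitmask M P < 2 ^ M.
Proof.
elim: M => [|M IH]; first by rewrite /bitmask big_geq.
rewrite bitmask_recr expnS mul2n -addnn -addSn leq_add //.
by case: (P M); rewrite ?mul1n.
Qed.

Lemma bit_bitmask M P t : t < M -> bit (bitmask M P) t = P t.
Proof.
elim: M => // M IH; rewrite ltnS leq_eqVlt bitmask_recr => /predU1P[->|lt_tM].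
  rewrite /bit addnC divnMDl ?expn_gt0 // divn_small ?bitmask_lt // addn0.
  by case: (P M).
(* For t < M, adding [2 ^ M] changes the quotient by [2 ^ t] by an even number. *)
rewrite -(IH lt_tM) /bit addnC -(subnK (ltnW lt_tM)) expnD mulnA.
rewrite divnMDl ?expn_gt0 // -(subnSK lt_tM) expnS mulnCA mulnC.
by rewrite modnMDl subnSK // subnK // ltnW.
Qed.

Definition triple Q a b c := (a * Q + b) * Q + c.
Definition triple1 Q t := t %/ Q %/ Q.
Definition triple2 Q t := (t %/ Q) %% Q.
Definition triple3 Q t := t %% Q.

Section Triple.
Variables (Q a b c : nat).
Hypotheses (lt_aQ : a < Q) (lt_bQ : b < Q) (lt_cQ : c < Q).

Let Q_gt0 : 0 < Q := leq_ltn_trans (leq0n a) lt_aQ.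

Lemma triple1E : triple1 Q (triple Q a b c) = a.
Proof.
by rewrite /triple1 divnMDl // (divn_small lt_cQ) addn0 divnMDl // divn_small ?addn0.
Qed.

Lemma triple2E : triple2 Q (triple Q a b c) = b.
Proof. by rewrite /triple2 divnMDl // (divn_small lt_cQ) addn0 modnMDl modn_small. Qed.

Lemma triple3E : triple3 Q (triple Q a b c) = c.
Proof. by rewrite /triple3 modnMDl modn_small. Qed.

Lemma triple_lt : triple Q a b c < Q * Q * Q.
Proof. rewrite /triple; nia. Qed.

End Triple.

Section WindowAutomaton.
Variables (k Q : nat) (G : nat -> nat -> nat).

(** For j < 2k this is the letter of index j in the image of the two-letter word yz under the
    k-uniform substitution [G]. *)
Definition pair_letter y z j := if j < k then G y j else G z (j - k).

(** The start moves from i to ki + e and the end from i + n to k(i + n) + (e + d). Since e + d + 1 <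
    2k, the new letters at the end and just after it lie in the image of the two letters stored in
    t. *)
Definition next_window t e d :=
  triple Q (G (triple1 Q t) e) (pair_letter (triple2 Q t) (triple3 Q t) (e + d))
    (pair_letter (triple2 Q t) (triple3 Q t) (e + d).+1).

Definition window_step q d := bitmask (Q * Q * Q) (fun t =>
  has (fun t' => bit q t' && has (fun e => t == next_window t' e d) (iota 0 k))
    (iota 0 (Q * Q * Q))).

Definition window_init t0 := iter (Q * Q * Q) (fun q =>
  bitmask (Q * Q * Q) (fun t => (t == t0) || bit (window_step q 0) t)) 0.

Lemma window_step_lt q d : window_step q d < 2 ^ (Q * Q * Q).
Proof. exact: bitmask_lt. Qed.

Lemma window_init_lt t0 : window_init t0 < 2 ^ (Q * Q * Q).
Proof.
by rewrite /window_init; case: (Q * Q * Q) => // M; rewrite iterS bitmask_lt.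
Qed.

Lemma window_stepP q d t : t < Q * Q * Q ->
  reflect (exists t' e, [/\ t' < Q * Q * Q, bit q t', e < k & t = next_window t' e d])
    (bit (window_step q d) t).
Proof.
move=> lt_tM; rewrite bit_bitmask //; apply: (iffP hasP) => [[t'] | [t' [e]]].
  rewrite mem_iota => /= lt_t' /andP[qt'] /hasP[e]; rewrite mem_iota => /= lt_e.
  by move/eqP; exists t', e.
case=> lt_t' qt' lt_e ->; exists t'; first by rewrite mem_iota.
by rewrite qt'; apply/hasP; exists e; rewrite ?mem_iota ?eqxx.
Qed.

Variable y : nat -> nat.
Hypotheses (k_gt1 : 1 < k) (lt_yQ : forall p, y p < Q).
Hypothesis y_rec : forall p d, d < k -> y (k * p + d) = G (y p) d.

(* The third component supplies the letter needed when adding the digit d to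
   the last digit of i produces a carry. *)
Definition window n i := triple Q (y i) (y (i + n)) (y (i + n).+1).

Definition represents q n := forall t, t < Q * Q * Q ->
  bit q t <-> exists i, t = window n i.

Lemma window_lt n i : window n i < Q * Q * Q.
Proof. exact: triple_lt. Qed.

Lemma pair_letterE p j : j < k + k -> pair_letter (y p) (y p.+1) j = y (k * p + j).
Proof.
rewrite /pair_letter => lt_j; case: ltnP => [lt_jk|le_kj]; first by rewrite y_rec.
rewrite -y_rec; last by rewrite ltn_subLR.
by congr y; rewrite mulnS addnAC subnKC // addnC.
Qed.

Lemma next_windowE n i e d : e < k -> d < k ->
  next_window (window n i) e d = window (k * n + d) (k * i + e).
Proof.
move=> lt_e lt_d; rewrite /next_window triple1E ?triple2E ?triple3E //.
rewrite -y_rec // !pair_letterE; try lia.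
by congr triple; congr y; lia.
Qed.

(** Every start position has the form ki + e with e < k, so the windows of length kn + d are exactly
    the successors of those of length n. *)
Lemma represents_step q n d :
  d < k -> represents q n -> represents (window_step q d) (k * n + d).
Proof.
move=> lt_d qn t lt_t; split.
  case/window_stepP=> // t' [e [lt_t' /qn[//|i ->] lt_e ->]].
  by exists (k * i + e); rewrite next_windowE.
case=> i ->; apply/window_stepP; first exact: window_lt.
exists (window n (i %/ k)), (i %% k); split; rewrite ?window_lt //.
- by apply/qn; [exact: window_lt | exists (i %/ k)].
- by rewrite ltn_mod; lia.
- by rewrite next_windowE ?ltn_mod //; [rewrite [k * (_ %/ _)]mulnC -divn_eq | lia].
Qed.

(* The windows at offset 0 are the least set containing the first one and
   closed under the step with digit 0, which is a fixpoint of a monotone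
   operator on a finite set, hence reached after at most as many iterations as
   there are codes. *)
Lemma represents_init : represents (window_init (triple Q (y 0) (y 0) (y 1))) 0.
Proof.
set M := Q * Q * Q; set t0 := triple _ _ _ _.
pose F (X : {set 'I_M}) : {set 'I_M} := [set t : 'I_M | (t == t0 :> nat) ||
  [exists t' : 'I_M, (t' \in X) &&
    has (fun e => t == next_window t' e 0 :> nat) (iota 0 k)]].
have F_mono : {homo F : X Z / X \subset Z}.
  move=> X Z /fintype.subsetP sXZ; apply/fintype.subsetP => t; rewrite !finset.inE.
  case/orP=> [->//|/existsP[t' /andP[/sXZ t'Z Ht']]].
  by apply/orP; right; apply/existsP; exists t'; rewrite t'Z.
have iterE N (t : 'I_M) : bit (iter N (fun q => bitmask M (fun t =>
    (t == t0) || bit (window_step q 0) t)) 0) t = (t \in iter N F finset.set0).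
  elim: N t => [|N IH] t.
    by rewrite /bit div0n mod0n finset.inE.
  rewrite !iterS bit_bitmask // finset.inE; congr orb.
  apply/window_stepP/existsP => // [[t' [e [lt_t' + lt_e ->]]]|[t' /andP[]]].
    rewrite (IH (Ordinal lt_t')) => t'X; exists (Ordinal lt_t'); rewrite t'X.
    by apply/hasP; exists e; rewrite ?mem_iota ?eqxx.
  rewrite -IH => t'X /hasP[e]; rewrite mem_iota => /= lt_e /eqP ->.
  by exists t', e.
(* [fixset F] is the iterate of F from the empty set of order [#|'I_M|] = M, the number of
   iterations in [window_init]. *)
have initE (t : 'I_M) : bit (window_init t0) t = (t \in fixset F).
  by rewrite /fixset card_ord -iterE.
have k_gt0 : 0 < k by exact: ltnW.
move=> t lt_t; rewrite (initE (Ordinal lt_t)); split=> [|[i def_t]].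
  rewrite /fixset; elim: #|_| t lt_t => [|N IH] t lt_t; first by rewrite finset.inE.
  rewrite iterS finset.inE => /orP[/eqP /= ->|/existsP[t' /andP[]]]; first by exists 0.
  case: t' => t' lt_t' /IH[i def_t'] /hasP[e]; rewrite mem_iota => /= lt_e /eqP ->.
  by exists (k * i + e); rewrite def_t' next_windowE // muln0.
elim/ltn_ind: i t lt_t def_t => i IH t lt_t def_t; rewrite -fixsetK // finset.inE /= def_t.
(* The window at 0 is t0; the one at i > 0 is a successor, with digit 0, of the window at [i %/ k] <
   i. *)
have [->|i_gt0] := posnP i; first by rewrite eqxx.
apply/orP; right; apply/existsP; exists (Ordinal (window_lt 0 (i %/ k))).
rewrite (IH (i %/ k)) ?ltn_Pdiv //=; apply/hasP; exists (i %% k).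
  by rewrite mem_iota ltn_mod.
by rewrite next_windowE ?ltn_mod // muln0 [k * (_ %/ _)]mulnC -divn_eq.
Qed.

Lemma represents_foldl (w : seq 'I_k) :
  represents (foldl (fun q (d : 'I_k) => window_step q d)
                (window_init (triple Q (y 0) (y 0) (y 1))) w)
             (foldl (fun m (d : 'I_k) => m * k + d) 0 w).
Proof.
elim/last_ind: w => [|w d IH]; first exact: represents_init.
by rewrite !foldl_rcons mulnC; apply: represents_step.
Qed.

End WindowAutomaton.

(** * Parikh-collinear morphisms *)

Lemma sum_count_mem (A : finType) (w : seq A) : \sum_(c : A) count_mem c w = size w.
Proof.
elim: w => [|b w IH] /=; first by rewrite big1.
rewrite big_split /= IH (bigD1 b) //= eqxx big1 ?addn0 //.
by move=> c /negPf; rewrite eq_sym => ->.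
Qed.

Lemma take_mkseq (T : Type) (x : nat -> T) m n :
  m <= n -> take m (mkseq x n) = mkseq x m.
Proof. by move=> le_mn; rewrite /mkseq -map_take take_iota (minn_idPl le_mn). Qed.

Lemma prefix_mkseq (T : eqType) (x : nat -> T) u n :
  prefix u (mkseq x n) -> u = mkseq x (size u).
Proof.
move=> /[dup] /size_prefix; rewrite size_mkseq => le_un.
by rewrite prefixE => /eqP <-; rewrite take_mkseq // size_mkseq.
Qed.

(** By monotonicity the thresholds h 1, h 2, ... that are at most p form an initial run, and its
    length is the index of the interval containing p. The search thus becomes a bounded sum, which a
    program can evaluate. *)
Lemma count_thresholds (h : nat -> nat) p n : h 0 <= p -> p < h n ->
    {homo h : i j / i <= j} ->
  let i := \sum_(0 <= j < n) (h j.+1 <= p) in [/\ i < n, h i <= p & p < h i.+1].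
Proof.
move=> le_h0 lt_hn h_mono i.
have ex_i : exists j, p < h j.+1.
  by case: n lt_hn {i} => [|n]; [rewrite ltnNge le_h0 | exists n].
case: (ex_minnP ex_i) => j lt_pj min_j.
have le_hj : h j <= p.
  case: j {lt_pj} min_j => // j min_j; rewrite leqNgt.
  by apply/negP => /min_j; rewrite ltnn.
have lt_jn : j < n.
  by rewrite ltnNge; apply/negP => /h_mono; rewrite leqNgt (leq_ltn_trans le_hj).
suff -> : i = j by [].
rewrite /i (big_cat_nat (n := j)) ?(ltnW lt_jn) //=.
rewrite (eq_big_nat _ _ (F2 := fun=> 1)) => [|j' /andP[_ /h_mono le_h]]; last first.
  by rewrite (leq_trans le_h).
rewrite sum_nat_const_nat subn0 muln1 big1_seq ?addn0 // => j' /=.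
rewrite mem_index_iota => /andP[le_jj' _].
by apply/eqP; rewrite eqb0 -ltnNge (leq_trans lt_pj) ?h_mono.
Qed.

(** * The fixed point as a concatenation of images of its letters *)

Section Morphism.
Variables (A : finType) (f : seq A -> seq A) (a : A) (x : nat -> A).
Hypotheses (f_morph : word_morphism f) (f_coll : parikh_collinear f).
Hypotheses (f_prol : prolongable f a) (x_fix : fixed_point f a x).

Lemma morphism_nil : f [::] = [::].
Proof.
have /(congr1 size)/eqP := f_morph [::] [::].
by rewrite size_cat -{1}[size _]addn0 eqn_add2l eq_sym => /nilP.
Qed.

Lemma size_morphism w : size (f w) = \sum_(c : A) count_mem c w * size (f [:: c]).
Proof.
elim: w => [|b w IH] /=; first by rewrite morphism_nil big1.
rewrite -cat1s f_morph size_cat IH.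
under [RHS]eq_bigr do rewrite mulnDl.
rewrite big_split /=; congr (_ + _); rewrite (bigD1 b) //= eqxx mul1n big1 ?addn0 //.
by move=> c /negPf; rewrite eq_sym => ->.
Qed.

Lemma prefix_morphism u v : prefix u v -> prefix (f u) (f v).
Proof. by move=> /prefixP[w ->]; rewrite f_morph prefix_prefix. Qed.

Lemma prefix_iter n : prefix (iter n f [:: a]) (iter n.+1 f [:: a]).
Proof.
elim: n => [|n IH]; last by rewrite !iterS prefix_morphism.
by have [[u fa] _] := f_prol; rewrite iterS fa -cat1s prefix_prefix.
Qed.

Lemma prefix_iterD n m : prefix (iter n f [:: a]) (iter (n + m) f [:: a]).
Proof.
elim: m => [|m IH]; first by rewrite addn0 prefix_refl.
by apply: prefix_trans IH _; rewrite addnS prefix_iter.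
Qed.

(** The iterates extend one another, so the letter at i in any of them is already its limit. *)
Lemma iter_mkseq n : iter n f [:: a] = mkseq x (size (iter n f [:: a])).
Proof.
apply: (@eq_from_nth _ a) => [|i lt_i]; first by rewrite size_mkseq.
rewrite nth_mkseq //; have [m Hm] := x_fix i.
have /prefixP[w Hw] := prefix_iterD n m.
have := Hm (n + m) (leq_addl _ _) => /(onth_nth a) <-.
by rewrite Hw nth_cat lt_i.
Qed.

(** As x = f(x_0) f(x_1) ..., this is the position at which the block f(x_N) starts. *)
Definition image_size N := size (f (mkseq x N)).
Local Notation s := image_size.

(** The prefix of length N of x is a prefix of some f^n(a), so its image is a prefix of f^(n+1)(a),
    hence of x. *)
Lemma morphism_mkseq N : f (mkseq x N) = mkseq x (s N).
Proof.
have [n Hn] := f_prol.2 N; have le_N := Hn n (leqnn n).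
apply: (@prefix_mkseq _ _ _ (size (iter n.+1 f [:: a]))).
rewrite -iter_mkseq iterS; apply: prefix_morphism.
by rewrite iter_mkseq -(take_mkseq _ le_N) prefix_take.
Qed.

Lemma image_size0 : s 0 = 0. Proof. by rewrite /s morphism_nil. Qed.

Lemma image_sizeS N : s N.+1 = s N + size (f [:: x N]).
Proof. by rewrite /s mkseqS -cats1 f_morph size_cat. Qed.

Lemma image_size_mono : {homo s : M N / M <= N}.
Proof. by apply: homo_leq leq_trans _ => // N; rewrite image_sizeS leq_addr. Qed.

Lemma image_size_unbounded p : exists N, p < s N.
Proof.
have [n Hn] := f_prol.2 p.+1; exists (size (iter n f [:: a])).
by rewrite /s -iter_mkseq -iterS Hn.
Qed.

Lemma mkseq_block N o : o <= size (f [:: x N]) ->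
  mkseq x (s N + o) = f (mkseq x N) ++ take o (f [:: x N]).
Proof.
move=> le_o; have := morphism_mkseq N.+1.
rewrite {1}mkseqS -cats1 f_morph => /(congr1 (take (s N + o))).
rewrite take_mkseq ?image_sizeS ?leq_add2l // => <-.
by rewrite take_cat ltnNge leq_addr /= addKn.
Qed.

Lemma block_letter N o : o < size (f [:: x N]) ->
  x (s N + o) = nth a (f [:: x N]) o.
Proof.
move=> lt_o; rewrite -(nth_mkseq a x (ltnSn (s N + o))) -addnS mkseq_block //.
by rewrite nth_cat ltnNge leq_addr /= addKn nth_take.
Qed.

Lemma locate_ex p : exists No, p = s No.1 + No.2 /\ No.2 < size (f [:: x No.1]).
Proof.
have [n lt_pn] := image_size_unbounded p.
have [] := count_thresholds _ lt_pn image_size_mono; first by rewrite image_size0.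
set N := \sum_(_ <= _ < _) _ => _ le_Np lt_pN; exists (N, p - s N); split => /=.
  by rewrite subnKC.
by rewrite ltn_subLR // -image_sizeS.
Qed.

(** If N < N', then s N + o < s (N + 1) <= s N'. The strict bounds on the offsets exclude empty
    blocks, across which s is constant. *)
Lemma locate_inj N o N' o' : s N + o = s N' + o' ->
  o < size (f [:: x N]) -> o' < size (f [:: x N']) -> N = N' /\ o = o'.
Proof.
move=> eq_p lt_o lt_o'; suff eqN : N = N'.
  by split=> //; move: eq_p; rewrite eqN => /addnI.
have := image_sizeS N; have := image_sizeS N'.
have [/image_size_mono|/image_size_mono|//] := ltngtP N N'; lia.
Qed.

(** * Consequences of collinearity: counts, lengths and positions *)

Let l := size (f [:: a]).
Let v c := count_mem c (f [:: a]).
Let k := eigenvalue f.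

Lemma prolong_letter : 0 < v a.
Proof. by have [[u fa] _] := f_prol; rewrite /v fa /= eqxx. Qed.

Lemma size_prolong_letter : 0 < l.
Proof. by have [[u fa] _] := f_prol; rewrite /l fa. Qed.

(** The letter a occurs in f(a), so in a dependency p Psi(f(b)) + q Psi(f(a)) = 0 the coefficient p
    is nonzero: otherwise q would vanish too. Hence Psi(f(b)) is a rational multiple of
    Psi(f(a)). *)
Lemma collinear_letter b c : count_mem c (f [:: b]) * l = size (f [:: b]) * v c.
Proof.
have cross d : count_mem c (f [:: b]) * v d = count_mem d (f [:: b]) * v c.
  have [p [q [nz_pq Hpq]]] := f_coll b a.
  have {Hpq} Hpq e : (p * (count_mem e (f [:: b]))%:Z + q * (v e)%:Z = 0)%R.
    by have := Hpq e; rewrite !ffunE.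
  have := prolong_letter; have := Hpq a; have := Hpq c; have := Hpq d.
  have [p0 _ _ Ha v_gt0|nz_p Hd Hc _ _] := eqVneq p 0%R.
    case: nz_pq; congr pair => //; move: Ha; rewrite p0 mul0r add0r => /eqP.
    by rewrite mulf_eq0 => /orP[/eqP //|]; lia.
  apply/eqP; rewrite -eqz_nat !PoszM -subr_eq0 -(mulrI_eq0 _ (mulfI nz_p)).
  rewrite mulrBr !mulrA -[(p * _)%R](addrK (q * (v c)%:Z)%R) Hc sub0r.
  rewrite -[(p * (count_mem d _)%:Z)%R](addrK (q * (v d)%:Z)%R) Hd sub0r.
  by rewrite !mulNr opprK addrC mulrAC subrr.
(* Summing the cross products over d turns the counts of d into lengths. *)
rewrite /l -!sum_count_mem big_distrr big_distrl /=.
by apply: eq_bigr => d _; rewrite cross.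
Qed.

Lemma collinear_word w c : count_mem c (f w) * l = size (f w) * v c.
Proof.
elim: w => [|b w IH]; first by rewrite morphism_nil.
by rewrite -cat1s f_morph count_cat size_cat !mulnDl IH collinear_letter.
Qed.

(** Psi(f(w)) is proportional to Psi(f(a)), and |f(c)| |f(a)|_c = |f(a)| |f(c)|_c by collinearity of
    f(c) and f(a); summing over c gives |f(f(a))| = k |f(a)|. *)
Lemma size_morphism2 w : size (f (f w)) = k * size (f w).
Proof.
apply/eqP; rewrite -(eqn_pmul2r size_prolong_letter) size_morphism; apply/eqP.
rewrite -mulnA /k /eigenvalue !big_distrl /=; apply: eq_bigr => c _.
by rewrite mulnAC collinear_word [RHS]mulnCA collinear_letter -mulnA [v c * _]mulnC.
Qed.

(** The length of f^(n+1)(a) is k^n |f(a)|, which would stay bounded for k <= 1. *)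
Lemma eigenvalue_gt1 : 1 < k.
Proof.
have size_iter n : size (iter n.+1 f [:: a]) = k ^ n * l.
  elim: n => [|n IH]; first by rewrite mul1n.
  by rewrite iterS size_morphism2 IH expnS mulnA.
rewrite ltnNge; apply/negP => k_le1; have [n Hn] := f_prol.2 l.+1.
have := Hn n.+1 (leqnSn n); rewrite size_iter ltnNge; case/negP.
rewrite -[leqRHS]mul1n leq_mul //.
by elim: (n) => // m IH; rewrite expnS -[leqRHS]mul1n leq_mul.
Qed.

Lemma image_size_block N i : i <= size (f [:: x N]) ->
  s (s N + i) = k * s N + size (f (take i (f [:: x N]))).
Proof.
by move=> le_i; rewrite {1}/s mkseq_block // f_morph size_cat size_morphism2.
Qed.

(** By collinearity the N complete blocks contribute s N times v c to the count multiplied by l;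
    adding o times v c completes s N to the position s N + o. *)
Lemma count_prefix N o c : o < size (f [:: x N]) ->
  count_mem c (mkseq x (s N + o)) * l + o * v c =
  (s N + o) * v c + count_mem c (take o (f [:: x N])) * l.
Proof.
move=> lt_o; rewrite mkseq_block 1?ltnW // count_cat mulnDl collinear_word.
by rewrite mulnDl addnAC.
Qed.

(** For p < |f(f(b))|, this is the index of the letter of f(b) whose image covers position p of
    f(f(b)), in the form of [count_thresholds]. *)
Definition subblock b p :=
  \sum_(0 <= i < size (f [:: b])) (size (f (take i.+1 (f [:: b]))) <= p).

Variables block offset : nat -> nat.
Hypothesis positionE : forall p,
  p = s (block p) + offset p /\ offset p < size (f [:: x (block p)]).

(** With p = s N + o and b = x_N, the copy of f(f(b)) coming from block N starts at k s N, and k p +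
    d is at distance k o + d < k |f(b)| = |f(f(b))| from there. So it lies in the image of some
    letter i of f(b), that is, in block s N + i. *)
Lemma position_rec p d : d < k ->
  let b := x (block p) in let i := subblock b (k * offset p + d) in
  [/\ i < size (f [:: b]), x (block (k * p + d)) = nth a (f [:: b]) i
   & offset (k * p + d) = k * offset p + d - size (f (take i (f [:: b])))].
Proof.
move=> lt_d b i; have [def_p lt_o] := positionE p.
pose h i := size (f (take i (f [:: b]))).
have h_mono : {homo h : i j / i <= j}.
  move=> i1 i2 le_i; apply: size_prefix; apply: prefix_morphism.
  by rewrite -(subnKC le_i) takeD prefix_prefix.
have [] := @count_thresholds h (k * offset p + d) (size (f [:: b])) _ _ h_mono.
- by rewrite /h take0 morphism_nil.
- rewrite /h take_size size_morphism2 (leq_trans _ (leq_mul (leqnn k) lt_o)) //.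
  by rewrite mulnS addnC ltn_add2r.
rewrite -/(subblock b _) -/i => lt_i le_h lt_h.
have [def_q lt_oq] := positionE (k * p + d).
have xE : x (s (block p) + i) = nth a (f [:: b]) i by rewrite block_letter.
have [||-> ->] := locate_inj (N' := s (block p) + i)
   (o' := k * offset p + d - h i) _ lt_oq; last by split.
- rewrite -def_q image_size_block 1?ltnW // -/b -/(h i) {1}def_p.
  rewrite -addnA subnKC //; lia.
rewrite xE ltn_subLR //; move: lt_h; rewrite /h (take_nth a) // -cats1 f_morph.
by rewrite size_cat.
Qed.

End Morphism.

(** * The automaton computed from a table of images *)

(* Below, [tb] is the code of the table of the images of the letters, [ra] is the
   rank of the letter [a], and letters are identified with their ranks. *)
Definition image_len tb b := code_size (code_nth tb b).
Definition image_letter tb b i := code_nth (code_nth tb b) i.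
Definition image_count tb b o c :=
  \sum_(0 <= i < o) (image_letter tb b i == c : nat).
Definition image2_len tb b i := \sum_(0 <= j < i) image_len tb (image_letter tb b j).
Definition table_eigenvalue tb :=
  \sum_(0 <= b < code_size tb) image_count tb b (image_len tb b) b.

(* The pair formed by the letter [b] and the offset [o] is coded by
   [b * offset_bound tb + o]. *)
Definition offset_bound tb := \sum_(0 <= b < code_size tb) image_len tb b.
Definition pair_bound tb := code_size tb * offset_bound tb.

Definition subblock_index tb b p :=
  \sum_(0 <= i < image_len tb b) (image2_len tb b i.+1 <= p : nat).

Definition subblock_pair tb b p :=
  image_letter tb b (subblock_index tb b p) * offset_bound tb +
  (p - image2_len tb b (subblock_index tb b p)).

(** This is the uniform substitution fixing the sequence of pairs: letter d of the image of (b, o)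
    is the pair found at position k o + d of f(f(b)). *)
Definition pair_subst tb y d :=
  subblock_pair tb (y %/ offset_bound tb)
    (table_eigenvalue tb * (y %% offset_bound tb) + d).

Definition table_step tb q d :=
  window_step (table_eigenvalue tb) (pair_bound tb) (pair_subst tb) q d.

(** As |f(a)| > 1, positions 0 and 1 both lie in the first block f(a), at offsets 0 and 1; the codes
    of y_0 and y_1 are therefore consecutive. *)
Definition table_init ra tb :=
  window_init (table_eigenvalue tb) (pair_bound tb) (pair_subst tb)
    (triple (pair_bound tb) (ra * offset_bound tb) (ra * offset_bound tb)
       (ra * offset_bound tb).+1).

Definition num_windows tb := pair_bound tb * pair_bound tb * pair_bound tb.

(* If y_p = (b, o), v = Psi(f(a)) and l = |f(a)|, then
   l * Psi(x[0..p)) + o * v = p * v + l * Psi(f(b)[0..o)).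
   The offset on the other endpoint is moved here so as to avoid subtraction. *)
Definition defect ra tb y z c :=
  image_count tb (y %/ offset_bound tb) (y %% offset_bound tb) c * image_len tb ra +
  z %% offset_bound tb * image_count tb ra (image_len tb ra) c.

(** The factor of length n at i has its count of c, times |f(a)|, equal to n |f(a)|_c +
    defect(y_(i+n), y_i) - defect(y_i, y_(i+n)). The test equates two such differences, with the
    negative terms moved across. *)
Definition same_defect ra tb c t t' :=
  defect ra tb (triple2 (pair_bound tb) t) (triple1 (pair_bound tb) t) c +
  defect ra tb (triple1 (pair_bound tb) t') (triple2 (pair_bound tb) t') c ==
  defect ra tb (triple2 (pair_bound tb) t') (triple1 (pair_bound tb) t') c +
  defect ra tb (triple1 (pair_bound tb) t) (triple2 (pair_bound tb) t) c.

Definition same_class ra tb t t' :=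
  ~~ has (fun c => ~~ same_defect ra tb c t t') (iota 0 (code_size tb)).

Definition table_out ra tb q := \sum_(0 <= t < num_windows tb)
  (bit q t && ~~ has (fun t' => bit q t' && same_class ra tb t t') (iota 0 t) : nat).

(** All bitmasks are states, reachable or not, so the rows are indexed by the states themselves. *)
Definition table_dfao_code ra tb :=
  CodeSeq.code
    [:: table_init ra tb;
        CodeSeq.code (mkseq (fun q => CodeSeq.code
          (mkseq (table_step tb q) (table_eigenvalue tb))) (2 ^ num_windows tb));
        CodeSeq.code (mkseq (table_out ra tb) (2 ^ num_windows tb))].

(** * Computability of the tables *)

Lemma computable_image_len : computable2 image_len.
Proof. by rewrite /computable2 /image_len; computability. Qed.
#[local] Hint Resolve computable_image_len : computable.

Lemma computable_image_letter : computable3 image_letter.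
Proof. by rewrite /computable3 /image_letter; computability. Qed.
#[local] Hint Resolve computable_image_letter : computable.

Lemma computable_image_count : computable4 image_count.
Proof. by rewrite /computable4 /image_count; computability. Qed.
#[local] Hint Resolve computable_image_count : computable.

Lemma computable_image2_len : computable3 image2_len.
Proof. by rewrite /computable3 /image2_len; computability. Qed.
#[local] Hint Resolve computable_image2_len : computable.

Lemma computable_table_eigenvalue : computable1 table_eigenvalue.
Proof. by rewrite /computable1 /table_eigenvalue; computability. Qed.
#[local] Hint Resolve computable_table_eigenvalue : computable.

Lemma computable_offset_bound : computable1 offset_bound.
Proof. by rewrite /computable1 /offset_bound; computability. Qed.
#[local] Hint Resolve computable_offset_bound : computable.

Lemma computable_pair_bound : computable1 pair_bound.
Proof. by rewrite /computable1 /pair_bound; computability. Qed.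
#[local] Hint Resolve computable_pair_bound : computable.

Lemma computable_subblock_index : computable3 subblock_index.
Proof. by rewrite /computable3 /subblock_index; computability. Qed.
#[local] Hint Resolve computable_subblock_index : computable.

Lemma computable_subblock_pair : computable3 subblock_pair.
Proof. by rewrite /computable3 /subblock_pair; computability. Qed.
#[local] Hint Resolve computable_subblock_pair : computable.

Lemma computable_pair_subst : computable3 pair_subst.
Proof. by rewrite /computable3 /pair_subst; computability. Qed.
#[local] Hint Resolve computable_pair_subst : computable.

Lemma computable_triple : computable4 triple.
Proof. by rewrite /computable4 /triple; computability. Qed.
#[local] Hint Resolve computable_triple : computable.

Lemma computable_triple1 : computable2 triple1.
Proof. by rewrite /computable2 /triple1; computability. Qed.
#[local] Hint Resolve computable_triple1 : computable.

Lemma computable_triple2 : computable2 triple2.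
Proof. by rewrite /computable2 /triple2; computability. Qed.
#[local] Hint Resolve computable_triple2 : computable.

Lemma computable_triple3 : computable2 triple3.
Proof. by rewrite /computable2 /triple3; computability. Qed.
#[local] Hint Resolve computable_triple3 : computable.

Lemma computable_table_step : computable3 table_step.
Proof.
rewrite /computable3 /table_step /window_step /bitmask /next_window /pair_letter /bit.
by computability.
Qed.
#[local] Hint Resolve computable_table_step : computable.

Lemma computable_table_init : computable2 table_init.
Proof.
rewrite /computable2 /table_init /window_init /window_step /bitmask.
by rewrite /next_window /pair_letter /bit; computability.
Qed.
#[local] Hint Resolve computable_table_init : computable.

Lemma computable_num_windows : computable1 num_windows.
Proof. by rewrite /computable1 /num_windows; computability. Qed.
#[local] Hint Resolve computable_num_windows : computable.

Lemma computable_table_out : computable3 table_out.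
Proof.
rewrite /computable3 /table_out /bit /same_class /same_defect /defect.
by computability.
Qed.
#[local] Hint Resolve computable_table_out : computable.

Lemma computable_code_cons n (F : env n -> nat) (s : env n -> seq nat) :
    computable F -> computable (fun u => CodeSeq.code (s u)) ->
  computable (fun u => CodeSeq.code (F u :: s u)).
Proof.
move=> cF cs; apply: (computable_eq (F := fun u =>
    2 ^ F u * (2 * CodeSeq.code (s u)).+1)); first by move=> u; rewrite mul2n.
by apply: computable_mul; [apply: computable_exp | apply: computable_S;
  apply: computable_mul] => //; apply: computable_const.
Qed.

Lemma computable_table_dfao_code : computable2 table_dfao_code.
Proof.
rewrite /computable2 /table_dfao_code.
do 3 (apply: computable_code_cons; first by computability).
exact: computable_const.
Qed.
#[local] Hint Resolve computable_table_dfao_code : computable.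

(** * Correctness *)

Local Open Scope fset_scope.
(* The classes of [eqv] are counted through their least representatives. *)
Lemma card_range (U : choiceType) (h : nat -> U) (t : nat -> nat) M
    (T : nat -> bool) (eqv : nat -> nat -> bool) :
    (forall i, t i < M) ->
    (forall s, s < M -> T s <-> exists i, s = t i) ->
    (forall i j, eqv (t i) (t j) <-> h i = h j) ->
  #|` fset_set (range h)| =
  (\sum_(0 <= s < M) (T s && ~~ has (fun s' => T s' && eqv s s') (iota 0 s) : nat))%N.
Proof.
move=> lt_tM TP eqvP.
(* g selects an occurrence of each code in T, so that h can be read off from codes. *)
have [g gP] : exists g, forall s, s < M -> T s -> t (g s) = s.
  suff /choice[g gP] : forall s, exists i, s < M -> T s -> t i = s by exists g.
  move=> s; have [[lt_s /TP[//|i ->]]|nTs] := pselect (s < M /\ T s); first by exists i.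
  by exists 0 => lt_s Ts; case: nTs.
pose P s := T s && ~~ has (fun s' => T s' && eqv s s') (iota 0 s).
pose R := [seq s <- iota 0 M | P s].
have RP s : s \in R -> [/\ s < M, T s & ~~ has (fun s' => T s' && eqv s s') (iota 0 s)].
  by rewrite mem_filter mem_iota => /andP[/andP[-> ->]].
have uniq_R : uniq (map (h \o g) R).
  (* Of two distinct codes in R with the same value of h, the larger would not be least in its
     class. *)
  rewrite map_inj_in_uniq ?filter_uniq ?iota_uniq // => s s' /RP[lt_s Ts min_s].
  move=> /RP[lt_s' Ts' min_s'] /= eq_h.
  have eqv_s : eqv s s' by rewrite -(gP s) // -(gP s') //; apply/eqvP.
  have eqv_s' : eqv s' s by rewrite -(gP s) // -(gP s') //; apply/eqvP.
  have [lt_ss|lt_ss|//] := ltngtP s s'.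
    by case/hasP: min_s'; exists s; rewrite ?mem_iota // Ts.
  by case/hasP: min_s; exists s'; rewrite ?mem_iota // Ts'.
have -> : range h = [set` [fset u in map (h \o g) R]]%classic.
  apply/seteqP; split=> [u [i _ <-]|u] /=; last first.
    by rewrite inE => /mapP[s _ ->]; exists (g s).
  rewrite inE; apply/mapP.
  have ex_s : exists s, T s && eqv (t i) s.
    by exists (t i); apply/andP; split; [apply/TP => //; exists i | apply/eqvP].
  (* The least code in T equivalent to [t i] has no smaller equivalent code in T, so it belongs to
     R. *)
  case: (ex_minnP ex_s) => s /andP[Ts eqv_s] min_s.
  have lt_s : s < M.
    apply: leq_ltn_trans (lt_tM i); apply: min_s; apply/andP.
    by split; [apply/TP => //; exists i | apply/eqvP].
  have hE : h i = h (g s) by apply/eqvP; rewrite gP.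
  exists s => //; rewrite mem_filter mem_iota /= add0n lt_s andbT /P Ts /=.
  apply/hasPn => s'; rewrite mem_iota add0n => /= lt_s'.
  apply/negP => /andP[Ts' eqv_s'].
  have := min_s s'; rewrite Ts' leqNgt lt_s' => /(_ _)/notF; apply.
  have lt_s'M := ltn_trans lt_s' lt_s.
  by rewrite -(gP s') //; apply/eqvP; rewrite hE; apply/eqvP; rewrite !gP.
rewrite set_fsetK card_fseq undup_id // size_map size_filter -sum1_count.
by rewrite [LHS]big_mkcond /index_iota subn0.
Qed.
Local Close Scope fset_scope.

Lemma sum_enum_rank (A : finType) (F : nat -> nat) :
  \sum_(0 <= i < #|A|) F i = \sum_(b : A) F (enum_rank b).
Proof.
rewrite big_mkord (reindex (@enum_rank A)) //=.
by apply: onW_bij; apply: enum_rank_bij.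
Qed.

(** * The automaton as a [dfao] and its code *)

Lemma table_step_lt tb q d : table_step tb q d < 2 ^ num_windows tb.
Proof. exact: window_step_lt. Qed.

Lemma table_init_lt ra tb : table_init ra tb < 2 ^ num_windows tb.
Proof. exact: window_init_lt. Qed.

(** With ordinals as states, the rank of a state is its value, so the coded tables are those of the
    numerical functions. *)
Definition table_dfao k ra tb : dfao k nat :=
  @Dfao k nat 'I_(2 ^ num_windows tb) (Ordinal (table_init_lt ra tb))
    (fun q d => Ordinal (table_step_lt tb q d)) (table_out ra tb).

Lemma table_dfao_run k ra tb (w : seq 'I_k) :
  dfao_run (table_dfao k ra tb) w =
  table_out ra tb (foldl (fun q (d : 'I_k) => table_step tb q d) (table_init ra tb) w).
Proof.
rewrite /dfao_run; congr table_out.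
by elim/last_ind: w => //= w d IH; rewrite !foldl_rcons /= IH.
Qed.

Lemma map_enum_ord (T : Type) n (F : nat -> T) : [seq F i | i : 'I_n] = mkseq F n.
Proof. by rewrite /mkseq -val_enum_ord -map_comp. Qed.

Lemma code_table_dfao k ra tb : table_eigenvalue tb = k ->
  code_dfao (table_dfao k ra tb) = table_dfao_code ra tb.
Proof.
move=> <-; rewrite /code_dfao /table_dfao_code -!map_enum_ord.
congr (CodeSeq.code [:: _; CodeSeq.code _; _]); first by rewrite enum_rank_ord.
rewrite -map_comp; apply: eq_map => q; congr (CodeSeq.code _).
rewrite /code_word -map_comp -map_enum_ord; apply: eq_map => d.
by rewrite /= enum_rank_ord.
Qed.

(** * The tables of a given morphism and the meaning of their entries *)

Section Instance.
Variables (A : finType) (f : seq A -> seq A) (a : A) (x : nat -> A).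
Hypotheses (f_morph : word_morphism f) (f_coll : parikh_collinear f).
Hypotheses (f_prol : prolongable f a) (x_fix : fixed_point f a x).

Let tb := code_table [seq code_word (f [:: b]) | b <- enum A].
Let rk (b : A) := nat_of_ord (enum_rank b).
Let ra := rk a.
Let k := eigenvalue f.

Lemma rk_inj : injective rk.
Proof. by move=> b c /val_inj/enum_rank_inj. Qed.

Lemma code_size_table : code_size tb = #|A|.
Proof. by rewrite /tb /code_table code_sizeE 2!size_map -cardE. Qed.

Lemma code_nth_table b : code_nth tb (rk b) = CodeSeq.code (code_word (f [:: b])).
Proof.
have lt_b : rk b < size (enum A) by rewrite -cardE ltn_ord.
rewrite /tb /code_table code_nthE (nth_map [::]) 1?size_map //.
by rewrite (nth_map a) // nth_enum_rank.
Qed.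

Lemma image_lenE b : image_len tb (rk b) = size (f [:: b]).
Proof. by rewrite /image_len code_nth_table code_sizeE size_map. Qed.

Lemma image_letterE b i : i < size (f [:: b]) ->
  image_letter tb (rk b) i = rk (nth a (f [:: b]) i).
Proof.
by move=> lt_i; rewrite /image_letter code_nth_table code_nthE (nth_map a).
Qed.

Lemma image_countE b o c : o <= size (f [:: b]) ->
  image_count tb (rk b) o (rk c) = count_mem c (take o (f [:: b])).
Proof.
elim: o => [|o IH] lt_o; first by rewrite take0 /image_count big_geq.
rewrite (take_nth a) // -cats1 count_cat -(IH (ltnW lt_o)) /image_count.
by rewrite big_nat_recr //= image_letterE // (inj_eq rk_inj) addn0.
Qed.

Lemma image2_lenE b i : i <= size (f [:: b]) ->
  image2_len tb (rk b) i = size (f (take i (f [:: b]))).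
Proof.
elim: i => [|i IH] lt_i.
  by rewrite take0 (morphism_nil f_morph) /image2_len big_geq.
rewrite (take_nth a) // -cats1 f_morph size_cat -(IH (ltnW lt_i)) /image2_len.
by rewrite big_nat_recr //= image_letterE // image_lenE.
Qed.

Lemma table_eigenvalueE : table_eigenvalue tb = k.
Proof.
rewrite /table_eigenvalue code_size_table sum_enum_rank; apply: eq_bigr => b _.
by rewrite image_lenE image_countE // take_size.
Qed.

Lemma offset_bound_ge b : size (f [:: b]) <= offset_bound tb.
Proof.
rewrite /offset_bound code_size_table sum_enum_rank (bigD1 b) //= image_lenE.
exact: leq_addr.
Qed.

Lemma subblock_indexE b p : subblock_index tb (rk b) p = subblock f b p.
Proof.
rewrite /subblock_index /subblock image_lenE; apply: eq_big_nat => i /andP[_ lt_i].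
by rewrite image2_lenE.
Qed.

Variables block offset : nat -> nat.
Hypothesis positionE : forall p,
  p = image_size f x (block p) + offset p /\ offset p < size (f [:: x (block p)]).

Let y p := rk (x (block p)) * offset_bound tb + offset p.

Lemma offset_lt p : offset p < offset_bound tb.
Proof. by have [_ lt_o] := positionE p; apply: leq_trans lt_o (offset_bound_ge _). Qed.

Lemma y_div p : y p %/ offset_bound tb = rk (x (block p)).
Proof.
have lt_o := offset_lt p; rewrite /y divnMDl ?(leq_ltn_trans _ lt_o) //.
by rewrite divn_small ?addn0.
Qed.

Lemma y_mod p : y p %% offset_bound tb = offset p.
Proof. by rewrite /y modnMDl modn_small ?offset_lt. Qed.

Lemma y_lt p : y p < pair_bound tb.
Proof.
apply: (@leq_trans ((rk (x (block p))).+1 * offset_bound tb)).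
  by rewrite /y mulSn addnC ltn_add2r offset_lt.
by rewrite /pair_bound code_size_table leq_mul2r ltn_ord orbT.
Qed.

Lemma y_rec p d : d < k -> y (k * p + d) = pair_subst tb (y p) d.
Proof.
move=> lt_d; rewrite /pair_subst y_div y_mod table_eigenvalueE /subblock_pair.
have [lt_i xE oE] := position_rec f_morph f_coll f_prol x_fix positionE p lt_d.
by rewrite subblock_indexE image_letterE // image2_lenE 1?ltnW // /y xE oE.
Qed.

Lemma fixed_point0 : x 0 = a.
Proof. by have [] := iter_mkseq f_morph f_prol x_fix 0. Qed.

Lemma size_prolong_gt1 : 1 < size (f [:: a]).
Proof.
have [[u fa] /(_ 2)[n Hn]] := f_prol; rewrite fa ltnS lt0n size_eq0.
apply/eqP => u0; rewrite u0 in fa; have := Hn n (leqnn n).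
suff -> : iter n f [:: a] = [:: a] by [].
by elim: (n) => // m IH; rewrite iterS IH.
Qed.

Lemma y_init o : o < 2 -> y o = ra * offset_bound tb + o.
Proof.
move=> lt_o; have [def_o lt_oo] := positionE o.
have [||bE oE] := locate_inj f_morph (N' := 0) (o' := o) _ lt_oo.
- by rewrite -def_o image_size0.
- by rewrite fixed_point0; apply: leq_trans lt_o size_prolong_gt1.
by rewrite /y bE oE fixed_point0.
Qed.

Definition window_parikh n i := parikh (mkseq (fun j => x (i + j)) n).

Lemma window_parikhE n i c :
  count_mem c (mkseq x (i + n)) = count_mem c (mkseq x i) + window_parikh n i c.
Proof.
rewrite /window_parikh ffunE -count_cat; congr count.
by rewrite /mkseq iotaD map_cat add0n -[i in iota i n]addn0 iotaDl -map_comp.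
Qed.

(** This is [count_prefix] with the offset of q added on both sides. The offset terms on the left
    are then symmetric in p and q, and cancel between the instances at (p, q) and (q, p). *)
Lemma defectE p q c :
  count_mem c (mkseq x p) * size (f [:: a]) +
    offset p * count_mem c (f [:: a]) + offset q * count_mem c (f [:: a]) =
  p * count_mem c (f [:: a]) + defect ra tb (y p) (y q) (rk c).
Proof.
have [def_p lt_o] := positionE p.
rewrite /defect y_div !y_mod /ra image_lenE image_countE 1?ltnW //.
rewrite image_countE // take_size addnA.
by rewrite {1 3}def_p count_prefix.
Qed.

Lemma same_defectE n i j c :
  same_defect ra tb (rk c) (window (pair_bound tb) y n i) (window (pair_bound tb) y n j)
  = (window_parikh n i c == window_parikh n j c).
Proof.
rewrite /same_defect /window !triple1E ?triple2E ?y_lt //.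
(* The counts are compared after multiplication by |f(a)| > 0; the terms in n |f(a)|_c agree for i
   and j, and the rest is linear in the four instances of [defectE]. *)
rewrite -[RHS](eqn_pmul2r (size_prolong_letter f_prol)).
have := defectE (i + n) i c; have := defectE j (j + n) c.
have := defectE (j + n) j c; have := defectE i (i + n) c.
rewrite !window_parikhE !mulnDl; lia.
Qed.

Lemma same_classE n i j :
  same_class ra tb (window (pair_bound tb) y n i) (window (pair_bound tb) y n j)
  <-> window_parikh n i = window_parikh n j.
Proof.
rewrite /same_class code_size_table; split=> [/hasPn same|eq_ij].
  apply/ffunP => c; apply/eqP; rewrite -same_defectE -[same_defect _ _ _ _ _]negbK.
  by apply: same; rewrite mem_iota /= ltn_ord.
apply/hasPn => c; rewrite mem_iota /= => lt_c; rewrite negbK.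
rewrite -[c]/(nat_of_ord (Ordinal lt_c)) -(enum_valK (Ordinal lt_c)).
by rewrite same_defectE eq_ij.
Qed.

Lemma factor_parikh n :
  [set parikh w | w in [set w | factor x w /\ size w = n]]%classic =
  range (window_parikh n).
Proof.
apply/seteqP; split=> [_ [w [[i ->] <-] <-]|_ [i _ <-]].
  by exists i => //; rewrite size_mkseq.
exists (mkseq (fun j => x (i + j)) n) => //; split; last by rewrite size_mkseq.
by exists i; rewrite size_mkseq.
Qed.

(** The Parikh vectors of the factors of length n form the range of [window_parikh n], whose
    elements correspond to the classes of windows under [same_class]. *)
Lemma table_outE q n : represents (pair_bound tb) y q n ->
  table_out ra tb q = abelian_complexity x n.
Proof.
move=> qn; rewrite /abelian_complexity factor_parikh /table_out.
rewrite (card_range (t := window (pair_bound tb) y n) (M := num_windows tb)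
  (T := bit q) (eqv := same_class ra tb)) //.
- by move=> i; apply: window_lt y_lt _ _.
- by move=> i j; apply: same_classE.
Qed.

Lemma table_dfao_generates : generates (table_dfao k ra tb) (abelian_complexity x).
Proof.
move=> n w [<- _]; rewrite table_dfao_run; apply: table_outE.
rewrite /table_step /table_init table_eigenvalueE.
(* This turns the initial window of the table into the one formed by [y 0], [y 0] and [y 1]. *)
rewrite -[ra * _]addn0 -addnS -y_init // -y_init //.
exact: (represents_foldl (eigenvalue_gt1 f_morph f_coll f_prol) y_lt y_rec w).
Qed.

End Instance.

Lemma table_dfao_correct (A : finType) (f : seq A -> seq A) (a : A) (x : nat -> A) :
    word_morphism f -> parikh_collinear f -> prolongable f a -> fixed_point f a x ->
  let ra := nat_of_ord (enum_rank a) in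
  let tb := code_table [seq code_word (f [:: b]) | b <- enum A] in
  generates (table_dfao (eigenvalue f) ra tb) (abelian_complexity x) /\
  code_dfao (table_dfao (eigenvalue f) ra tb) = table_dfao_code ra tb.
Proof.
move=> f_morph f_coll f_prol x_fix ra tb; split; last first.
  apply: code_table_dfao; exact: table_eigenvalueE.
have [No NoP] := choice (locate_ex f_morph f_prol x_fix).
apply: (table_dfao_generates f_morph f_coll f_prol x_fix (block := fun p => (No p).1)
  (offset := fun p => (No p).2)).
exact: NoP.
Qed.

Theorem theorem3 :
  (forall (A : finType) (f : seq A -> seq A) (a : A) (x : nat -> A),
     word_morphism f -> parikh_collinear f -> prolongable f a ->
     fixed_point f a x ->
     automatic (eigenvalue f) (abelian_complexity x)) /\
  (exists p : recprog,
     forall (A : finType) (f : seq A -> seq A) (a : A) (x : nat -> A),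
       word_morphism f -> parikh_collinear f -> prolongable f a ->
       fixed_point f a x ->
       exists D : dfao (eigenvalue f) nat,
         generates D (abelian_complexity x) /\
         rec_eval p [:: code_instance f a] (code_dfao D)).
Proof.
split=> [A f a x f_morph f_coll f_prol x_fix|].
  have [gen _] := table_dfao_correct f_morph f_coll f_prol x_fix.
  by split; [apply: eigenvalue_gt1 f_prol | eexists; apply: gen].
(* Entries 0 and 1 of the coded instance are the rank of a and the table of images. *)
have : computable1 (fun c => table_dfao_code (code_nth c 0) (code_nth c 1)).
  by rewrite /computable1; computability.
move=> [p Hp]; exists p => A f a x f_morph f_coll f_prol x_fix.
have [gen codeE] := table_dfao_correct f_morph f_coll f_prol x_fix.
eexists; split; first exact: gen.
by rewrite codeE; have := Hp (code_instance f a, tt); rewrite /code_instance !code_nthE.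
Qed.
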